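(* Realize the real quaternions $\mathbb H$ (imaginary units $i_1,i_2,i_3$ with $i_1^2=i_2^2=i_3^2=i_1i_2i_3=-1$) as complex $2\times2$ matrices $$q_0+q_1i_1+q_2i_2+q_3i_3=\begin{pmatrix} q_0+iq_3 & -q_2+iq_1\\ q_2+iq_1 & q_0-iq_3\end{pmatrix},$$ where $i$ denotes the complex imaginary unit. For $k\in\mathbb N_0$ let $\mathcal M_k(\mathbb R^3,\mathbb H)$ be the space of $\mathbb H$-valued polynomials $g$ in $y=(y_0,y_1,y_2)\in\mathbb R^3$, homogeneous of degree $k$, with $Dg=0$, where $D=\frac{\partial}{\partial y_0}+i_1\frac{\partial}{\partial y_1}+i_2\frac{\partial}{\partial y_2}$; regard it as a right $\mathbb H$-linear Hilbert space with inner product $(Q,R)_{\mathbb H}=\int_{B_3}\overline Q R\,dV$ ($B_3$ the unit ball, $dV$ Lebesgue measure). Suppose that for each $k\in\mathbb N_0$, $\{g^k_j\mid j=0,\dots,k\}$ is an orthogonal basis of $\mathcal M_k(\mathbb R^3,\mathbb H)$ such that: (i) for $j=0,\dots,k$, if $h^k_j$ and $h^k_{2k+1-j}$ denote the first and second column of the matrix-valued polynomial $g^k_j$, then $Hh^k_j=(k+\frac12-j)h^k_j$ and $Hh^k_{2k+1-j}=-(k+\frac12-j)h^k_{2k+1-j}$, where $H=-i\big(\frac{i_3}{2}+y_2\frac{\partial}{\partial y_1}-y_1\frac{\partial}{\partial y_2}\big)$ (with $i_3$ acting by matrix multiplication on column vectors); (ii) $\frac{\partial g^k_j}{\partial y_0}=k\,g^{k-1}_{j-1}$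 for $j=1,\dots,k$ and $\frac{\partial g^k_0}{\partial y_0}=0$; (iii) $g^k_0=(y_1-i_3y_2)^k$. Then, in spherical coordinates $y_0=r\cos\theta$, $y_1=r\sin\theta\cos\varphi$, $y_2=r\sin\theta\sin\varphi$ ($r\ge0$, $-\pi\le\varphi\le\pi$, $0\le\theta\le\pi$), $$g^k_j(r,\theta,\varphi)=\frac{k!}{j!}(-2)^{k-j}r^k\big(g^k_{j,0}+g^k_{j,1}i_1+g^k_{j,2}i_2+g^k_{j,3}i_3\big),$$ where $$g^k_{j,0}=P^{j-k}_k(\cos\theta)\cos(j-k)\varphi,\qquad g^k_{j,1}=-j\,P^{j-k-1}_k(\cos\theta)\cos(j-k-1)\varphi,$$ $$g^k_{j,2}=j\,P^{j-k-1}_k(\cos\theta)\sin(j-k-1)\varphi,\qquad g^k_{j,3}=P^{j-k}_k(\cos\theta)\sin(j-k)\varphi,$$ and $P^l_k(s)=\frac{1}{k!\,2^k}(1-s^2)^{l/2}\frac{d^{l+k}}{ds^{l+k}}(s^2-1)^k$, $s\in\mathbb R$.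
   Context: $\overline q=q_0-q_1i_1-q_2i_2-q_3i_3$ is quaternion conjugation. $P^0_k$ is the $k$-th Legendre polynomial and $P^l_k$ are its associated Legendre functions. (The existence of such bases, and their uniqueness under conditions (i)–(iii), is known from earlier work of Bock–Gürlebeck and Bock–Gürlebeck–Lávička–Souček.) *)

(* Defs.v *)
From HB Require Import structures.
From mathcomp Require Import all_boot all_order all_algebra.
From mathcomp Require Import all_classical all_reals all_analysis.
From mathcomp Require complex.
Import complex.ComplexField.

Set Implicit Arguments.
Unset Strict Implicit.
Unset Printing Implicit Defensive.

Import Order.TTheory GRing.Theory Num.Theory.
Local Open Scope ring_scope.

Section Quaternions.
Variable R : realType.

Record quat := Quat { q0 : R; q1 : R; q2 : R; q3 : R }.

Definition qzero : quat := Quat 0 0 0 0.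
Definition qadd (a b : quat) : quat :=
  Quat (q0 a + q0 b) (q1 a + q1 b) (q2 a + q2 b) (q3 a + q3 b).
(* Hamilton product, i1^2 = i2^2 = i3^2 = i1 i2 i3 = -1 (so i1 i2 = i3) *)
Definition qmul (a b : quat) : quat :=
  Quat (q0 a * q0 b - q1 a * q1 b - q2 a * q2 b - q3 a * q3 b)
       (q0 a * q1 b + q1 a * q0 b + q2 a * q3 b - q3 a * q2 b)
       (q0 a * q2 b - q1 a * q3 b + q2 a * q0 b + q3 a * q1 b)
       (q0 a * q3 b + q1 a * q2 b - q2 a * q1 b + q3 a * q0 b).
Definition qconj (a : quat) : quat := Quat (q0 a) (- q1 a) (- q2 a) (- q3 a).
Definition qscale (c : R) (a : quat) : quat :=
  Quat (c * q0 a) (c * q1 a) (c * q2 a) (c * q3 a).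
Definition qone : quat := Quat 1 0 0 0.
Definition qi1 : quat := Quat 0 1 0 0.
Definition qi2 : quat := Quat 0 0 1 0.
Definition qi3 : quat := Quat 0 0 0 1.
Fixpoint qpow (a : quat) (n : nat) : quat :=
  if n is n'.+1 then qmul (qpow a n') a else qone.

Local Notation C := (complex.complex R).
Definition iC : C := complex.Complex 0 1.
Definition RC (x : R) : C := complex.Complex x 0.

Definition qmat (q : quat) : 'M[C]_2 :=
  \matrix_(a < 2, b < 2)
    (if (a : nat) == 0%N then
       (if (b : nat) == 0%N then complex.Complex (q0 q) (q3 q)
        else complex.Complex (- q2 q) (q1 q))
     else
       (if (b : nat) == 0%N then complex.Complex (q2 q) (q1 q)
        else complex.Complex (q0 q) (- q3 q))).

Definition rfun := R -> R -> R -> R.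
Definition qfun := R -> R -> R -> quat.
Definition cfun := R -> R -> R -> C.
Definition colfun := R -> R -> R -> 'cV[C]_2.

Definition pd0 (f : rfun) : rfun := fun y0 y1 y2 => derive1 (fun t => f t y1 y2) y0.
Definition pd1 (f : rfun) : rfun := fun y0 y1 y2 => derive1 (fun t => f y0 t y2) y1.
Definition pd2 (f : rfun) : rfun := fun y0 y1 y2 => derive1 (fun t => f y0 y1 t) y2.

Definition qpd (d : rfun -> rfun) (g : qfun) : qfun := fun y0 y1 y2 =>
  Quat (d (fun a b c => q0 (g a b c)) y0 y1 y2)
       (d (fun a b c => q1 (g a b c)) y0 y1 y2)
       (d (fun a b c => q2 (g a b c)) y0 y1 y2)
       (d (fun a b c => q3 (g a b c)) y0 y1 y2).

Definition cpd (d : rfun -> rfun) (u : cfun) : cfun := fun y0 y1 y2 =>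
  complex.Complex (d (fun a b c => complex.Re (u a b c)) y0 y1 y2)
                  (d (fun a b c => complex.Im (u a b c)) y0 y1 y2).

Definition colpd (d : rfun -> rfun) (h : colfun) : colfun := fun y0 y1 y2 =>
  \col_(a < 2) cpd d (fun x0 x1 x2 => h x0 x1 x2 a ord0) y0 y1 y2.

Definition Dop (g : qfun) : qfun := fun y0 y1 y2 =>
  qadd (qpd pd0 g y0 y1 y2)
       (qadd (qmul qi1 (qpd pd1 g y0 y1 y2)) (qmul qi2 (qpd pd2 g y0 y1 y2))).

Definition hpoly (k : nat) (f : rfun) : Prop :=
  exists c : nat -> nat -> R, forall y0 y1 y2,
    f y0 y1 y2 = \sum_(a < k.+1) \sum_(b < (k - a).+1)
                    c a b * (y0 ^+ a * y1 ^+ b * y2 ^+ (k - a - b)).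

Definition Mk (k : nat) (g : qfun) : Prop :=
  [/\ hpoly k (fun a b c => q0 (g a b c)), hpoly k (fun a b c => q1 (g a b c)),
      hpoly k (fun a b c => q2 (g a b c)), hpoly k (fun a b c => q3 (g a b c)) &
      forall y0 y1 y2, Dop g y0 y1 y2 = qzero].

Definition leb3 := ((@lebesgue_measure R \x @lebesgue_measure R) \x
                    @lebesgue_measure R)%E.
Definition ball3 : set ((R * R) * R) :=
  [set p | p.1.1 ^+ 2 + p.1.2 ^+ 2 + p.2 ^+ 2 <= 1].

Definition qip (Q P : qfun) : quat :=
  let F := fun p : (R * R) * R =>
             qmul (qconj (Q p.1.1 p.1.2 p.2)) (P p.1.1 p.1.2 p.2) in
  Quat (Rintegral leb3 ball3 (fun p => q0 (F p)))
       (Rintegral leb3 ball3 (fun p => q1 (F p)))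
       (Rintegral leb3 ball3 (fun p => q2 (F p)))
       (Rintegral leb3 ball3 (fun p => q3 (F p))).

Definition qcomb (k : nat) (b : nat -> qfun) (a : nat -> quat) : qfun :=
  fun y0 y1 y2 => \big[qadd/qzero]_(j < k.+1) qmul (b j y0 y1 y2) (a j).

Definition orth_basis (k : nat) (b : nat -> qfun) : Prop :=
  [/\ forall j, (j <= k)%N -> Mk k (b j),
      forall j l, (j <= k)%N -> (l <= k)%N -> j <> l -> qip (b j) (b l) = qzero,
      forall f, Mk k f -> exists a : nat -> quat,
          forall y0 y1 y2, f y0 y1 y2 = qcomb k b a y0 y1 y2 &
      forall a : nat -> quat, (forall y0 y1 y2, qcomb k b a y0 y1 y2 = qzero) ->
          forall j, (j <= k)%N -> a j = qzero].

Definition qcol (c : 'I_2) (g : qfun) : colfun := fun y0 y1 y2 =>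
  col c (qmat (g y0 y1 y2)).

Definition Hop (h : colfun) : colfun := fun y0 y1 y2 =>
  (- iC) *: ((RC 2)^-1 *: (qmat qi3 *m h y0 y1 y2)
             + RC y2 *: colpd pd1 h y0 y1 y2
             - RC y1 *: colpd pd2 h y0 y1 y2).

(* associated Legendre function
   P^l_k(s) = 1/(k! 2^k) (1 - s^2)^(l/2) d^(l+k)/ds^(l+k) (s^2 - 1)^k.
   The order l + k is used through absz; it is a natural number in every
   instance where the value matters. *)
Definition legP (k : nat) (l : int) (s : R) : R :=
  (k`!%:R * 2 ^+ k)^-1 * powR (1 - s ^+ 2) (l%:~R / 2) *
  (((('X ^+ 2 - 1 : {poly R}) ^+ k)^`(absz (l + k%:Z))).[s]).

End Quaternions.

Arguments qzero {R}.
Arguments qi1 {R}.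
Arguments qi2 {R}.
Arguments qi3 {R}.

(* Main.v *)
(* At a fixed point y, the equation D g = 0, Euler's identity for a homogeneous
   polynomial of degree k, and the eigenvalue condition on the first column of g
   are linear in g and its first derivatives.  Eliminating the derivatives along
   y1 and y2 leaves
     j a + (2k + 1 - j) b = (y0 + y1 i1 + y2 i2) (d g / d y0),
   where g = a + b, a commutes with i3 and b anticommutes with i3.  By (ii) this
   determines g^k_j algebraically from g^(k-1)_(j-1), so the formula follows by
   induction on j from (iii): the coefficients obey two three-term relations for
   the derivatives of (s^2 - 1)^k.  At the poles sin theta = 0 the factor
   (1 - s^2)^(l/2) is 0 for l < 0 ([powR 0 x = 0] for x <> 0), which is the
   right limit of P^l_k, and for l = 0 one uses that (s^2 - 1)^k vanishes to
   order k. *)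
Require Import Defs.
From HB Require Import structures.
From mathcomp Require Import all_boot all_order all_algebra.
From mathcomp Require Import all_classical all_reals all_analysis.
From mathcomp Require Import ring lra zify.

Import Order.TTheory GRing.Theory Num.Theory.
Local Open Scope ring_scope.
Import complex.ComplexField.

(** * Euler's identity and the weight condition at a fixed point *)

(** The factor [x] restores the exponent lowered by differentiation, so terms of exponent 0 need no
    exception. *)
Lemma derive1_monomials (R : realType) (n : nat) (m : nat -> nat)
    (C : nat -> nat -> R) (e : nat -> nat -> nat) (x : R) :
  x * derive1 (fun t : R => \sum_(i < n) \sum_(j < m i) C i j * t ^+ e i j) x
  = \sum_(i < n) \sum_(j < m i) (e i j)%:R * (C i j * x ^+ e i j).
Proof.
pose p : {poly R} := \sum_(i < n) \sum_(j < m i) C i j *: 'X^(e i j).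
have -> : (fun t : R => \sum_(i < n) \sum_(j < m i) C i j * t ^+ e i j)
          = horner p.
  apply/funext => t; rewrite /p horner_sum; apply: eq_bigr => i _.
  by rewrite horner_sum; apply: eq_bigr => j _; rewrite hornerZ hornerXn.
rewrite -derivE /p raddf_sum horner_sum mulr_sumr; apply: eq_bigr => i _.
rewrite raddf_sum horner_sum mulr_sumr; apply: eq_bigr => j _ /=.
rewrite derivZ derivXn hornerZ hornerMn hornerXn.
case: (e i j) => [|d]; first by rewrite mulr0n !mulr0 mul0r.
by rewrite /= exprS -mulr_natr; ring.
Qed.

Lemma euler_hpoly (R : realType) (k : nat) (f : rfun R) (y0 y1 y2 : R) :
  hpoly k f ->
  y0 * pd0 f y0 y1 y2 + y1 * pd1 f y0 y1 y2 + y2 * pd2 f y0 y1 y2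
  = k%:R * f y0 y1 y2.
Proof.
move=> [c fE]; rewrite /pd0 /pd1 /pd2 fE.
have -> : (fun t => f t y1 y2) = (fun t => \sum_(a < k.+1)
    \sum_(b < (k - a).+1) (c a b * (y1 ^+ b * y2 ^+ (k - a - b))) * t ^+ a).
  apply/funext => t; rewrite fE; apply: eq_bigr => a _.
  by apply: eq_bigr => b _; ring.
have -> : (fun t => f y0 t y2) = (fun t => \sum_(a < k.+1)
    \sum_(b < (k - a).+1) (c a b * (y0 ^+ a * y2 ^+ (k - a - b))) * t ^+ b).
  apply/funext => t; rewrite fE; apply: eq_bigr => a _.
  by apply: eq_bigr => b _; ring.
have -> : (fun t => f y0 y1 t) = (fun t => \sum_(a < k.+1)
    \sum_(b < (k - a).+1) (c a b * (y0 ^+ a * y1 ^+ b)) * t ^+ (k - a - b)).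
  apply/funext => t; rewrite fE; apply: eq_bigr => a _.
  by apply: eq_bigr => b _; ring.
rewrite (derive1_monomials _ _ (fun a => (k - a).+1)
  (fun a b => c a b * (y1 ^+ b * y2 ^+ (k - a - b))) (fun a b => a)).
rewrite (derive1_monomials _ _ (fun a => (k - a).+1)
  (fun a b => c a b * (y0 ^+ a * y2 ^+ (k - a - b))) (fun a b => b)).
rewrite (derive1_monomials _ _ (fun a => (k - a).+1)
  (fun a b => c a b * (y0 ^+ a * y1 ^+ b)) (fun a b => (k - a - b)%N)).
rewrite mulr_sumr -!big_split; apply: eq_bigr => a _ /=.
rewrite mulr_sumr -!big_split; apply: eq_bigr => b _ /=.
have -> : k%:R = a%:R + b%:R + (k - a - b)%:R :> R.
  by rewrite -!natrD; congr _%:R; move: (ltn_ord a) (ltn_ord b); lia.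
by ring.
Qed.

(** Multiply D g = 0 on the left by y1 i1 + y2 i2. The derivatives along y1 and y2 combine into -(y1
    d1 + y2 d2), known by Euler's identity, and i3 (y1 d2 - y2 d1), known from the eigenvalue k +
    1/2 - j; its sign differs on the parts commuting and anticommuting with i3. *)
Lemma weight_recursion (R : realType) (k j : nat) (g : qfun R)
    (y0 y1 y2 : R) :
  Mk k g ->
  Hop (qcol 0 g) y0 y1 y2 = RC (k%:R + 2^-1 - j%:R) *: qcol 0 g y0 y1 y2 ->
  let a := g y0 y1 y2 in
  let yw := qmul (Quat y0 y1 y2 0) (qpd (@pd0 R) g y0 y1 y2) in
  [/\ j%:R * q0 a = q0 yw, (2 * k%:R + 1 - j%:R) * q1 a = q1 yw,
      (2 * k%:R + 1 - j%:R) * q2 a = q2 yw & j%:R * q3 a = q3 yw].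
Proof.
move=> [p0 p1 p2 p3 /(_ y0 y1 y2)].
rewrite /Dop /qpd /qadd /qmul /= => -[D0 D1 D2 D3] H.
have := euler_hpoly _ _ _ y0 y1 y2 p0; have := euler_hpoly _ _ _ y0 y1 y2 p1.
have := euler_hpoly _ _ _ y0 y1 y2 p2; have := euler_hpoly _ _ _ y0 y1 y2 p3.
(* The first column has entries q0 + i q3 and q2 + i q1, so it carries all four components. *)
have hE0 : (fun x0 x1 x2 => complex.Re (qcol 0 g x0 x1 x2 0 ord0))
           = (fun a b c => q0 (g a b c)).
  by apply/funext => a; apply/funext => b; apply/funext => c; rewrite !mxE.
have hE3 : (fun x0 x1 x2 => complex.Im (qcol 0 g x0 x1 x2 0 ord0))
           = (fun a b c => q3 (g a b c)).
  by apply/funext => a; apply/funext => b; apply/funext => c; rewrite !mxE.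
have hE2 : (fun x0 x1 x2 => complex.Re (qcol 0 g x0 x1 x2 1 ord0))
           = (fun a b c => q2 (g a b c)).
  by apply/funext => a; apply/funext => b; apply/funext => c; rewrite !mxE.
have hE1 : (fun x0 x1 x2 => complex.Im (qcol 0 g x0 x1 x2 1 ord0))
           = (fun a b c => q1 (g a b c)).
  by apply/funext => a; apply/funext => b; apply/funext => c; rewrite !mxE.
have := congr1 (fun A : 'cV_2 => A 0 0) H.
have := congr1 (fun A : 'cV_2 => A 1 0) H.
move=> {H}.
rewrite /Hop !mxE /cpd /= !big_ord_recl !big_ord0 !mxE /=.
rewrite hE0 hE1 hE2 hE3 /RC /iC.
have -> : (complex.Complex 2 0)^-1 = complex.Complex 2^-1 0 :> complex.complex R.
  by rewrite [LHS]/GRing.inv /=; congr complex.Complex; field.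
move: (g y0 y1 y2) D0 D1 D2 D3 => [a0 a1 a2 a3] /=.
do 4![move: (pd0 _ _ _ _); move=> ?]; do 4![move: (pd1 _ _ _ _); move=> ?].
do 4![move: (pd2 _ _ _ _); move=> ?].
move=> D0 D1 D2 D3 [H2 H1] [H0 H3] E3 E2 E1 E0.
split; nra.
Qed.

(** * Derivatives of (s^2 - 1)^k *)

Section Rodrigues.
Variable R : realType.
Implicit Types (s : R) (p : {poly R}).

Definition rodrigues (k m : nat) (s : R) : R :=
  ((('X ^+ 2 - 1 : {poly R}) ^+ k)^`(m)).[s].

(** Leibniz's rule stops after two terms; at [m = 0] the truncated [m.-1] is harmless, as its term
    has multiplicity 0. *)
Lemma derivnXM p m : ('X * p)^`(m) = 'X * p^`(m) + p^`(m.-1) *+ m.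
Proof.
case: m => [|m]; first by rewrite mulr0n addr0.
by rewrite mulrC -[p * 'X]addr0 -[0]/(0%:P) derivnMXaddC mulrC addrC mulrC.
Qed.

(* [Q_k' = 2 k s Q_(k-1)] for [Q_k = (s^2 - 1)^k], differentiated [m] times. *)
Lemma rodriguesSS k m s : rodrigues k.+1 m.+1 s
  = 2 * k.+1%:R * (s * rodrigues k m s + m%:R * rodrigues k m.-1 s).
Proof.
rewrite /rodrigues derivSn deriv_exp /= derivB derivXn derivC subr0 /=.
have -> : ('X *+ 2 * ('X ^+ 2 - 1) ^+ k *+ k.+1 : {poly R})
   = (2 * k.+1%:R) *: ('X * ('X ^+ 2 - 1) ^+ k).
  by rewrite -mul_polyC polyCM !polyC_natr; ring.
rewrite derivnZ hornerZ derivnXM hornerD hornerM hornerX hornerMn.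
by rewrite -[_ *+ m]mulr_natl.
Qed.

Lemma rodriguesS k m s : rodrigues k.+1 m s
  = (s ^+ 2 - 1) * rodrigues k m s + 2 * m%:R * s * rodrigues k m.-1 s
    + m%:R * m.-1%:R * rodrigues k m.-2 s.
Proof.
rewrite /rodrigues exprS.
have -> : (('X ^+ 2 - 1) * ('X ^+ 2 - 1) ^+ k : {poly R})
   = 'X * ('X * ('X ^+ 2 - 1) ^+ k) - ('X ^+ 2 - 1) ^+ k by ring.
rewrite derivnB !derivnXM !hornerE !hornerMn !hornerE.
rewrite hornerMn; set p := _ ^+ k; ring.
Qed.

(** Subtract [m] times [rodriguesSS] from 2(k + 1) times [rodriguesS]: the terms in [m.-2]
    cancel. *)
Lemma rodrigues_lower k m s : (2 * k.+1%:R - m%:R) * rodrigues k.+1 m s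
  = 2 * k.+1%:R * (s * m%:R * rodrigues k m.-1 s
                   - (1 - s ^+ 2) * rodrigues k m s).
Proof.
rewrite mulrBl {1}rodriguesS; case: m => [|m]; first by rewrite /=; ring.
by rewrite rodriguesSS /=; ring.
Qed.

(** Here [s] is a root of order k + 1. By induction: at s^2 = 1, [rodrigues_lower] leaves only a
    multiple of the previous value, and its left coefficient is nonzero. *)
Lemma rodrigues_pole k s : s ^+ 2 = 1 -> rodrigues k.+1 k s = 0.
Proof.
move=> s1; elim: k => [|k IH].
  by rewrite /rodrigues derivn0 expr1 !hornerE s1 subrr.
have := rodrigues_lower k.+1 k.+1 s.
rewrite s1 subrr mul0r subr0 /= IH mulr0 mulr0 => /eqP.
rewrite mulf_eq0 => /orP[|/eqP //].
have -> : 2 * k.+2%:R - k.+1%:R = k.+3%:R :> R by rewrite -!natr1; ring.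
by rewrite pnatr_eq0.
Qed.

End Rodrigues.

(** * Legendre recurrences in degree and order *)

Lemma legPE (R : realType) (k m : nat) (l : int) (s : R) :
  l + k%:Z = m%:Z ->
  legP k l s = (k`!%:R * 2 ^+ k)^-1 * powR (1 - s ^+ 2) (l%:~R / 2)
               * rodrigues R k m s.
Proof. by move=> lk; rewrite /legP lk. Qed.

Lemma legendre_normS (R : realType) (k : nat) :
  (k.+1`!%:R * 2 ^+ k.+1)^-1 * (2 * k.+1%:R) = (k`!%:R * 2 ^+ k)^-1 :> R.
Proof.
rewrite factS natrM exprS.
have fk : k`!%:R != 0 :> R by rewrite pnatr_eq0 -lt0n fact_gt0.
have k1 : k.+1%:R != 0 :> R by rewrite pnatr_eq0.
have t2 : 2 ^+ k != 0 :> R by rewrite expf_neq0 // pnatr_eq0.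
move: k1 fk t2; move: k.+1%:R k`!%:R (2 ^+ k) => x y z x0 y0 z0.
by field; apply/and3P.
Qed.

(** Strict positivity excludes [S = 0], [l = 0], where the left side is 1 and the right side 0. *)
Lemma powR_sqr_half_pred (R : realType) (S : R) (l : int) : 0 < S ->
  powR (S ^+ 2) (l%:~R / 2) = S * powR (S ^+ 2) ((l - 1)%:~R / 2).
Proof.
move=> S0; have -> : l%:~R / 2 = 2^-1 + (l - 1)%:~R / 2 :> R.
  by rewrite rmorphB /=; field.
rewrite powRD; last by rewrite expf_neq0 ?implybT // gt_eqF.
by rewrite powR12_sqrt ?sqr_ge0 // sqrtr_sqr gtr0_norm.
Qed.

Section LegendreRecursion.
Variables (R : realType) (k j : nat) (s S : R).
Hypotheses (jk : (j <= k)%N) (S0 : 0 <= S) (sS : 1 - s ^+ 2 = S ^+ 2).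
Let l : int := j%:Z - k%:Z.

Let legP1 : legP k.+1 l s = (k`!%:R * 2 ^+ k)^-1 *
  powR (S ^+ 2) (l%:~R / 2) *
  (s * rodrigues R k j s + j%:R * rodrigues R k j.-1 s).
Proof.
rewrite (@legPE _ _ j.+1); last by rewrite /l; lia.
rewrite rodriguesSS sS -(legendre_normS R k).
by ring.
Qed.

Let legP_pred : j%:R * legP k (l - 1) s = (k`!%:R * 2 ^+ k)^-1 *
  powR (S ^+ 2) ((l - 1)%:~R / 2) * (j%:R * rodrigues R k j.-1 s).
Proof.
(* For [j = 0] the order of differentiation would be -1, which [absz] turns into 1; the factor [j]
   removes this value. *)
have [->|j0] := posnP j; first by rewrite !mul0r mulr0.
by rewrite (@legPE _ _ j.-1) ?sS; [ring|rewrite /l; lia].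
Qed.

Lemma legP_recl :
  legP k.+1 l s = s * legP k l s + S * (j%:R * legP k (l - 1) s).
Proof.
rewrite legP1 legP_pred (@legPE _ k j); last by rewrite /l; lia.
rewrite sS; have [S_gt0|S_le0] := ltP 0 S.
  by rewrite (powR_sqr_half_pred _ S l) //; ring.
have S_0 : S = 0 by apply/eqP; rewrite eq_le S_le0.
rewrite S_0 mul0r addr0 expr0n /=.
have [lt_jk|] := ltnP j k.
  rewrite powR0; first by ring.
  by rewrite mulf_neq0 ?invr_neq0 ?pnatr_eq0 // intr_eq0 /l; lia.
(* At a pole with [l = 0] the power is 1, so the term in [j.-1] must vanish by itself. *)
move=> kj; have -> : j = k by lia.
case: k => [|k'] /=; first by ring.
rewrite rodrigues_pole; first by ring.
by move: sS; rewrite S_0 expr0n /= => /eqP; rewrite subr_eq0 => /eqP.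
Qed.

Lemma legP_recr : (2 * k.+1%:R - j%:R) * legP k.+1 (l - 1) s
  = s * (j%:R * legP k (l - 1) s) - S * legP k l s.
Proof.
(* Both sides contain a factor [S], so this form survives at [S = 0]. *)
have E : S * powR (S ^+ 2) (l%:~R / 2)
  = S ^+ 2 * powR (S ^+ 2) ((l - 1)%:~R / 2).
  have [S_gt0|S_le0] := ltP 0 S; first by rewrite powR_sqr_half_pred //; ring.
  have -> : S = 0 by apply/eqP; rewrite eq_le S_le0.
  by rewrite !(mul0r, expr0n).
rewrite legP_pred (@legPE _ k j); last by rewrite /l; lia.
rewrite (@legPE _ k.+1 j); last by rewrite /l; lia.
rewrite mulrCA rodrigues_lower sS.
rewrite [S * _]mulrA [S * (_ * _)]mulrCA E -(legendre_normS R k); ring.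
Qed.

End LegendreRecursion.

(** * The case j = 0 in spherical coordinates *)

(** De Moivre's formula in the commutative plane spanned by 1 and i3. *)
Lemma qpow_polar (R : realType) (rho ph : R) (k : nat) :
  qpow (Quat (rho * cos ph) 0 0 (- (rho * sin ph))) k
  = Quat (rho ^+ k * cos (k%:R * ph)) 0 0 (- (rho ^+ k * sin (k%:R * ph))).
Proof.
elim: k => [|k IH]; first by rewrite /= mul0r cos0 sin0 /qone; congr Quat; ring.
rewrite /= IH /qmul /=.
have -> : k.+1%:R * ph = k%:R * ph + ph by rewrite -natr1; ring.
by rewrite cosD sinD exprS; congr Quat; ring.
Qed.

(** At order -k no derivative remains, and the sign of (s^2 - 1)^k is absorbed by (-2)^k. *)
Lemma legP_sectoral (R : realType) (k : nat) (s S : R) :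
  0 <= S -> 1 - s ^+ 2 = S ^+ 2 ->
  k`!%:R * (-2) ^+ k * legP k (- k%:Z) s = S ^+ k.
Proof.
move=> S0 sS; rewrite (@legPE _ _ 0); last by rewrite addNr.
have -> : rodrigues R k 0 s = (-1) ^+ k * (S ^+ k * S ^+ k).
  have -> : (-1) ^+ k * (S ^+ k * S ^+ k) = (s ^+ 2 - 1) ^+ k.
    by rewrite -!exprMn -[S * S]/(S ^+ 2) -sS; congr (_ ^+ _); ring.
  by rewrite /rodrigues derivn0 horner_exp !hornerE.
have fk : k`!%:R != 0 :> R by rewrite pnatr_eq0 -lt0n fact_gt0.
have t2 : 2 ^+ k != 0 :> R by rewrite expf_neq0 // pnatr_eq0.
have m1 : (-1) ^+ k * (-1) ^+ k = 1 :> R by rewrite -exprMn mulrNN mulr1 expr1n.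
have -> : (-2) ^+ k = (-1) ^+ k * 2 ^+ k :> R by rewrite -exprMn mulN1r.
have -> (W : R) : k`!%:R * ((-1) ^+ k * 2 ^+ k) * ((k`!%:R * 2 ^+ k)^-1 * W *
    ((-1) ^+ k * (S ^+ k * S ^+ k)))
  = ((-1) ^+ k * (-1) ^+ k) * (W * S ^+ k * S ^+ k).
  by move: fk t2; move: k`!%:R (2 ^+ k) => y z y0 z0; field; apply/andP.
rewrite m1 mul1r sS.
have [S_gt0|S_le0] := ltP 0 S.
  have -> : powR (S ^+ 2) ((- k%:Z)%:~R / 2) = S ^- k.
    rewrite -powR_mulrn // -powRrM -powR_invn //; congr powR.
    by rewrite rmorphN /=; field.
  by rewrite mulVf ?mul1r // expf_neq0 // gt_eqF.
have -> : S = 0 by apply/eqP; rewrite eq_le S_le0.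
case: k {fk t2 m1} => [|k]; last by rewrite !(exprS, mul0r, mulr0).
by rewrite oppr0 mul0r powRr0 !expr0 !mulr1.
Qed.

(** * Induction on j *)

Theorem theorem3p6 (R : realType) (g : nat -> nat -> qfun R)
  (Hbasis : forall k : nat, orth_basis k (g k))
  (Hi : forall (k j : nat), (j <= k)%N -> forall y0 y1 y2 : R,
      Hop (qcol 0 (g k j)) y0 y1 y2
        = RC (k%:R + 2^-1 - j%:R) *: qcol 0 (g k j) y0 y1 y2 /\
      Hop (qcol 1 (g k j)) y0 y1 y2
        = - RC (k%:R + 2^-1 - j%:R) *: qcol 1 (g k j) y0 y1 y2)
  (Hii : forall (k j : nat), (1 <= j <= k)%N -> forall y0 y1 y2 : R,
      qpd (@pd0 R) (g k j) y0 y1 y2 = qscale k%:R (g k.-1 j.-1 y0 y1 y2))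
  (Hii0 : forall (k : nat) (y0 y1 y2 : R),
      qpd (@pd0 R) (g k 0%N) y0 y1 y2 = qzero)
  (Hiii : forall (k : nat) (y0 y1 y2 : R),
      g k 0%N y0 y1 y2 = qpow (Quat y1 0 0 (- y2)) k) :
  forall (k j : nat) (r th ph : R), (j <= k)%N ->
    0 <= r -> 0 <= th <= pi -> - pi <= ph <= pi ->
    let s := cos th in
    let l := (j%:Z - k%:Z)%R in
    g k j (r * cos th) (r * sin th * cos ph) (r * sin th * sin ph)
    = qscale (k`!%:R / j`!%:R * (-2) ^+ (k - j) * r ^+ k)
        (Quat (legP k l s * cos (l%:~R * ph))
              (- j%:R * legP k (l - 1) s * cos ((l - 1)%:~R * ph))
              (j%:R * legP k (l - 1) s * sin ((l - 1)%:~R * ph))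
              (legP k l s * sin (l%:~R * ph))).
Proof.
move=> k j r th ph jk _ /andP[th0 thpi] _ s l.
have S0 : 0 <= sin th by apply: sin_ge0_pi; rewrite th0.
have sS : 1 - s ^+ 2 = sin th ^+ 2 by rewrite /s sin2cos2.
(* The degree [k] stays general because the step goes from (k, j) to (k + 1, j + 1), which preserves
   [l]. *)
rewrite {}/l; elim: j k jk => [|j IH] k jk.
  rewrite Hiii qpow_polar.
  rewrite sub0r fact0 divr1 subn0 /qscale /=.
  have lE := legP_sectoral _ k _ _ S0 sS.
  have -> : (- k%:Z)%:~R * ph = - (k%:R * ph) by rewrite rmorphN mulNr.
  rewrite cosN sinN.
  congr Quat; rewrite ?oppr0 ?(mul0r, mulr0) //.
  - by rewrite exprMn -lE; ring.
  - by rewrite exprMn -lE; ring.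
case: k jk => [//|k]; rewrite ltnS => jk.
set y0 := r * s; set y1 := _ * cos ph; set y2 := _ * sin ph.
have [Mg _ _ _] := Hbasis k.+1.
have [] := weight_recursion _ _ _ _ y0 y1 y2 (Mg j.+1 jk) (Hi k.+1 j.+1 jk y0 y1 y2).1.
rewrite (Hii k.+1 j.+1) //= IH //.
have -> : j.+1%:Z - k.+1%:Z = j%:Z - k%:Z by lia.
have := legP_recl _ _ _ _ _ jk S0 sS.
have := legP_recr _ _ _ _ _ jk S0 sS.
set l : int := j%:Z - k%:Z => recr recl; clearbody l.
rewrite /qscale /= subSS.
set c := _ / _ * _ * r ^+ k.+1.
set c' := _ / _ * _ * r ^+ k.
(* The factor k + 1 comes from (ii), and [r] from the linear factor y0 + y1 i1 + y2 i2. *)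
have cE : k.+1%:R * c' * r = j.+1%:R * c.
  rewrite /c /c' !factS !natrM exprS.
  have fj : j`!%:R != 0 :> R by rewrite pnatr_eq0 -lt0n fact_gt0.
  have j1 : j.+1%:R != 0 :> R by rewrite pnatr_eq0.
  by move: fj j1; move: j`!%:R j.+1%:R => x y x0 y0'; field; apply/andP.
(* Multiplication by y1 i1 + y2 i2 exchanges the frequencies [l] and [l - 1] in [ph]. *)
have lph : l%:~R * ph = (l - 1)%:~R * ph + ph by rewrite rmorphB /=; ring.
have mph : (l - 1)%:~R * ph = l%:~R * ph - ph by rewrite rmorphB /=; ring.
have := esym (cosD ((l - 1)%:~R * ph) ph).
have := esym (sinD ((l - 1)%:~R * ph) ph).
have := esym (cosB (l%:~R * ph) ph); have := esym (sinB (l%:~R * ph) ph).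
rewrite -lph -mph {lph mph}.
have j1 : j.+1%:R != 0 :> R by rewrite pnatr_eq0.
have j2 : 2 * k.+1%:R + 1 - j.+1%:R != 0 :> R.
  rewrite -[j.+1%:R]natr1 opprD addrA addrAC addrK subr_eq0 -natrM eqr_nat; lia.
move: (g k.+1 j.+1 y0 y1 y2) => [a0 a1 a2 a3] /=.
move: (cos (l%:~R * ph)) (sin (l%:~R * ph)).
move: (cos ((l - 1)%:~R * ph)) (sin ((l - 1)%:~R * ph)).
move=> cm sm cl sl smE cmE slE clE A0 A1 A2 A3.
(* The weight coefficient is exactly the one in [legP_recr]. *)
have j2E : 2 * k.+1%:R + 1 - j.+1%:R = 2 * k.+1%:R - j%:R :> R.
  by rewrite -[j.+1%:R]natr1; ring.
(* Components 0 and 3 follow from [legP_recl], components 1 and 2 from [legP_recr], after cancelling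
   the weight coefficient. *)
congr Quat.
- apply: (mulfI j1); rewrite A0 recl [RHS]mulrA -cE.
  transitivity (k.+1%:R * c' * r * (s * legP k l s * cl
    + sin th * (j%:R * legP k (l - 1) s) * (cm * cos ph - sm * sin ph))).
    by rewrite /y0 /y1 /y2; ring.
  by rewrite clE; ring.
- apply: (mulfI j2); rewrite A1 j2E.
  transitivity (- (k.+1%:R * c' * r * (s * (j%:R * legP k (l - 1) s) * cm
    - sin th * legP k l s * (cl * cos ph + sl * sin ph)))).
    by rewrite /y0 /y1 /y2; ring.
  by rewrite cmE cE -mulrBl -recr; ring.
- apply: (mulfI j2); rewrite A2 j2E.
  transitivity (k.+1%:R * c' * r * (s * (j%:R * legP k (l - 1) s) * sm
    - sin th * legP k l s * (sl * cos ph - cl * sin ph))).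
    by rewrite /y0 /y1 /y2; ring.
  by rewrite smE cE -mulrBl -recr; ring.
- apply: (mulfI j1); rewrite A3 recl [RHS]mulrA -cE.
  transitivity (k.+1%:R * c' * r * (s * legP k l s * sl
    + sin th * (j%:R * legP k (l - 1) s) * (sm * cos ph + cm * sin ph))).
    by rewrite /y0 /y1 /y2; ring.
  by rewrite slE; ring.
Qed.
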